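(* Let $p$ be a prime, let $q$ be a power of $p$, and let $\mathcal{L}=\langle F,G\rangle$ be a pencil of plane curves of degree $d$ in $\mathbb{P}^2$ defined over $\mathbb{F}_q$ with no $\mathbb{F}_q$-points in its base locus. Assume that $q=p$ or $d\le p$. Then at least $\frac{q+1}{3}$ distinct $\mathbb{F}_q$-members of $\mathcal{L}$ are nonblocking curves.
   Context: A pencil of plane curves $\mathcal{L}=\langle F,G\rangle$ of degree $d$ over $\mathbb{F}_q$ is given by two linearly independent homogeneous polynomials $F,G\in\mathbb{F}_q[x,y,z]$ of the same degree $d\ge 1$. Its $\mathbb{F}_q$-members are the $q+1$ plane curves $C_{[s:t]}=\{sF+tG=0\}\subset\mathbb{P}^2$ for $[s:t]\in\mathbb{P}^1(\mathbb{F}_q)$; members are counted by their parameters $[s:t]$. The pencil has no $\mathbb{F}_q$-points in its base locus if there is no $P\in\mathbb{P}^2(\mathbb{F}_q)$ with $F(P)=G(P)=0$. A set $B\subseteq\mathbb{P}^2(\mathbb{F}_q)$ is a blocking set if every $\mathbb{F}_q$-line (line in $\mathbb{P}^2$ defined over $\mathbb{F}_q$) meets $B$, i.e. contains a point of $B$. A plane curve $C$ defined over $\mathbb{F}_q$ is a blocking curve if its set $C(\mathbb{F}_q)$ of $\mathbb{F}_q$-points is a blocking set, and is nonblocking otherwise. *)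

(* Defs.v *)
From HB Require Import structures.
From mathcomp Require Import all_boot all_order all_algebra.
From mathcomp Require Import mpoly.

Set Implicit Arguments.
Unset Strict Implicit.
Unset Printing Implicit Defensive.

Import GRing.Theory.
Local Open Scope ring_scope.

Section ProjectiveSpace.
Variables (K : finFieldType) (n : nat).

Definition scalar_class (v : 'rV[K]_n.+1) : {set 'rV[K]_n.+1} :=
  [set a *: v | a in [set~ 0 : K]].

(* The K-rational points of projective n-space: classes of nonzero vectors
   modulo multiplication by a nonzero scalar. *)
Definition proj : Type :=
  {P : {set 'rV[K]_n.+1} | P \in [set scalar_class v | v in [set~ 0]]}.
HB.instance Definition _ := Finite.on proj.

Definition representative (P : proj) : 'rV[K]_n.+1 :=
  odflt 0 [pick v in val P].

Lemma representativeP (P : proj) :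
  representative P != 0 /\ val P = scalar_class (representative P).
Proof.
have /imsetP[v v0 Pv] := valP P; rewrite !inE in v0.
rewrite /representative; case: pickP => [w|/(_ v)] /=; last first.
  by rewrite Pv => /negP[]; apply/imsetP; exists 1; rewrite ?inE ?oner_eq0 ?scale1r.
rewrite Pv => /imsetP[a]; rewrite !inE => a0 ->.
split; first by rewrite scaler_eq0 negb_or a0.
apply/setP => u; apply/imsetP/imsetP => -[b]; rewrite !inE => b0 ->.
  by exists (b / a); rewrite ?inE ?mulf_neq0 ?invr_eq0 // scalerA divfK.
by exists (b * a); rewrite ?inE ?mulf_neq0 // scalerA.
Qed.

Definition hcoord (P : proj) (i : 'I_n.+1) : K := representative P 0 i.

End ProjectiveSpace.

Section PlaneCurves.
Variable K : finFieldType.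

(* A plane curve over K is given by a homogeneous equation f; see
   [mem_ratpoints] for independence of the coordinates chosen by [hcoord]. *)
Definition ratpoints (f : {mpoly K[3]}) : {set proj K 2} :=
  [set P | f.@[hcoord P] == 0].

Lemma mem_ratpoints (d : nat) (f : {mpoly K[3]}) (P : proj K 2) (v : 'rV[K]_3) :
  f \is d.-homog -> v \in val P -> (P \in ratpoints f) = (f.@[v 0] == 0).
Proof.
move=> fd; have [_ ->] := representativeP P.
move=> /imsetP[a]; rewrite !inE => a0 ->.
suff -> : f.@[(a *: representative P) 0] = a ^+ d * f.@[hcoord P].
  by rewrite mulf_eq0 expf_eq0 (negPf a0) andbF.
rewrite !mevalE mulr_sumr; apply: eq_big_seq => m mf.
rewrite mulrCA; congr (_ * _).
have <- : mdeg m = d := dhomog_mf fd mf.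
rewrite mdegE -prodrXr -big_split /=.
by apply: eq_bigr => i _; rewrite mxE exprMn.
Qed.

Definition linear_form (a : 'rV[K]_3) : {mpoly K[3]} :=
  \sum_(i < 3) a 0 i *: 'X_i.

Definition blocking_set (B : {set proj K 2}) : bool :=
  [forall a : 'rV[K]_3,
     (a != 0) ==> [exists P in B, P \in ratpoints (linear_form a)]].

Definition blocking_curve (f : {mpoly K[3]}) : bool :=
  blocking_set (ratpoints f).

Definition is_pencil (d : nat) (F G : {mpoly K[3]}) : Prop :=
  [/\ (0 < d)%N, F \is d.-homog, G \is d.-homog
    & forall a b : K, a *: F + b *: G = 0 -> a = 0 /\ b = 0].

(* Equation s F + t G of the member with parameter [s : t]; another
   representative of [s : t] gives a nonzero multiple of this equation. *)
Definition member (F G : {mpoly K[3]}) (m : proj K 1) : {mpoly K[3]} :=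
  hcoord m 0 *: F + hcoord m 1 *: G.

Definition no_rational_base_point (F G : {mpoly K[3]}) : Prop :=
  forall P : proj K 2, ~ (P \in ratpoints F /\ P \in ratpoints G).

End PlaneCurves.

(* Main.v *)
Require Import Defs.
From mathcomp Require Import all_boot all_order all_algebra all_field.
From mathcomp Require Import mpoly.
From mathcomp Require Import ring zify.

(* The members of the pencil partition the rational points of the plane.  If
   one of them contains a line, every blocking member meets that line, so it is
   the only blocking one.  Otherwise every line meets every member in at most p
   points, by Bezout if d <= p and trivially if q = p, and it suffices that a
   blocking set B with this property satisfies 2 |B| > 3 q + 1.

   For the latter, in the style of Blokhuis, take B minimal, P in B and a
   tangent at P as the line at infinity.  If it is the only tangent at P, then
   B minus P meets every affine line and Jamison's bound gives |B| >= 2 q.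
   Otherwise let x run over the abscissas of the affine points, P being the
   vertical direction.  All nonvertical lines are blocked, so
   f = prod (X + x) has the lacunary form X^q g + h with deg g, deg h <= k,
   where |B| = q + k + 1.  As f splits over F_q, it divides
   (X g + h) (f' g - f g'), which has degree < q + k if 2 k < q, hence
   vanishes.  If X g + h = 0 then every x occurs and P has no second tangent;
   if f' g = f g' then, all multiplicities of f being less than p, f divides
   g, which has smaller degree. *)

Set Implicit Arguments.
Unset Strict Implicit.
Unset Printing Implicit Defensive.

Import Order.TTheory GRing.Theory Num.Theory.
Local Open Scope ring_scope.

(** * Lacunary polynomials from affine blocking sets *)

(** The translation x -> x + 1 permutes K, so adding q times 1 to the sum of all elements does not
    change it. *)
Lemma natr_card_finField (K : finFieldType) : #|K|%:R = 0 :> K.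
Proof.
have /eqP : \sum_(x : K) x = \sum_(x : K) (x + 1).
  exact: (reindex_inj (addIr 1)).
by rewrite big_split /= sumr_const -[eqbLHS]addr0 (inj_eq (addrI _)) => /eqP.
Qed.

Lemma sum_expr_finField (K : finFieldType) (e : nat) : (e <= #|K|.-1)%N ->
  \sum_(x : K) x ^+ e = if (e == #|K|.-1)%N then -1 else 0.
Proof.
have K_gt1 := card_finNzRing_gt1 K.
case: eqVneq => [-> _|e_neq e_le].
  rewrite (bigD1 0) //= expr0n -subn1 subn_eq0 leqNgt K_gt1 add0r.
  rewrite (eq_bigr (fun=> 1)) => [|x x0].
    rewrite sumr_const cardC1 -subn1 natrB ?natr_card_finField ?sub0r //.
    exact: ltnW.
  by apply: (mulfI x0); rewrite subn1 -exprS prednK ?expf_card ?mulr1 // ltnW.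
have {e_le e_neq} e_lt : (e < #|K|.-1)%N by rewrite ltn_neqAle e_neq.
(* For e = 0 the term at x = 0 is also 1, so the sum is q times 1. *)
have [e0|e_gt0] := posnP e.
  by rewrite e0 (eq_bigr (fun=> 1)) // sumr_const natr_card_finField.
have [y /andP[y0 ye]] : exists y : K, (y != 0) && (y ^+ e != 1).
  apply/existsP; apply: contraLR e_lt => /existsPn yP; rewrite -leqNgt.
  have Xe0 : 'X^e - 1%:P != 0 :> {poly K}.
    by rewrite -size_poly_eq0 size_XnsubC.
  have := @max_poly_roots _ _ (enum [set~ 0 : K]) Xe0 _ (enum_uniq _).
  rewrite size_XnsubC // -cardE cardsC1 ltnS; apply.
  apply/allP => y; rewrite mem_enum !inE rootE !hornerE => y0.
  by have := yP y; rewrite y0 negbK /= subr_eq0.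
(* Multiplication by y permutes K and scales the sum by y^e, which is not 1. *)
apply/eqP; move: ye; rewrite -subr_eq0 => ye.
rewrite -(mulrI_eq0 _ (mulfI ye)) mulrBl mul1r mulr_sumr subr_eq0.
rewrite [X in _ == X](reindex (fun x => y * x)) /=; last first.
  by exists (fun x => y^-1 * x) => x _; rewrite ?mulKf ?mulVKf.
by apply/eqP/eq_bigr => x _; rewrite exprMn.
Qed.

(* The coefficient formula behind the combinatorial Nullstellensatz. *)
Lemma sum_horner2 (K : finFieldType) (F : {poly {poly K}}) (m n : nat) :
    (m <= #|K|.-1)%N -> (n <= #|K|.-1)%N ->
    (forall i j, (m + n < i + j)%N -> F`_i`_j = 0) ->
  \sum_(t : K) \sum_(s : K)
     t ^+ (#|K|.-1 - m) * s ^+ (#|K|.-1 - n) * F.[t%:P].[s] = F`_m`_n.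
Proof.
set k := #|K|.-1 => mk nk Fdeg; set D := (m + n).+1.
have sF i : (size (F`_i)%R <= D)%N.
  by apply/leq_sizeP => j jD; apply: Fdeg; lia.
have sF' : (size F <= D)%N.
  apply/leq_sizeP => i iD; apply/polyP => j; rewrite coef0.
  by apply: Fdeg; lia.
have evF t s : F.[t%:P].[s] = \sum_(i < D) \sum_(j < D) F`_i`_j * (t ^+ i * s ^+ j).
  rewrite (horner_coef_wide _ sF') horner_sum; apply: eq_bigr => i _.
  rewrite -polyC_exp hornerM hornerC (horner_coef_wide _ (sF i)) mulr_suml.
  by apply: eq_bigr => j _; rewrite -mulrA [s ^+ j * _]mulrC.
transitivity (\sum_(i < D) \sum_(j < D) F`_i`_j *
   ((\sum_(t : K) t ^+ (k - m + i)) * (\sum_(s : K) s ^+ (k - n + j)))).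
  under eq_bigr => t _ do under eq_bigr => s _ do rewrite evF mulr_sumr.
  under eq_bigr => t _ do rewrite exchange_big /=.
  rewrite exchange_big /=; apply: eq_bigr => i _.
  under eq_bigr => t _ do under eq_bigr => s _ do rewrite mulr_sumr.
  under eq_bigr => t _ do rewrite exchange_big /=.
  rewrite exchange_big /=; apply: eq_bigr => j _.
  rewrite mulr_suml mulr_sumr; apply: eq_bigr => t _.
  rewrite !mulr_sumr; apply: eq_bigr => s _.
  by rewrite !exprD; ring.
have mD : (m < D)%N by rewrite /D; lia.
have nD : (n < D)%N by rewrite /D; lia.
(* Only (m, n) survives: any other (i, j) with i + j <= m + n has i < m or j < n, so one of its
   power sums has exponent below k and vanishes. *)
rewrite (bigD1 (Ordinal mD)) //= (bigD1 (Ordinal nD)) //=.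
rewrite !subnK // !sum_expr_finField // eqxx mulrNN mulr1 mulr1.
rewrite !big1 ?addr0 // => [i im|j jn].
  apply: big1 => j _; have := Fdeg i j.
  case: (ltnP (m + n) (i + j)) => [_ ->|ij _]; rewrite ?mul0r //.
  have {}im : (i != m :> nat) by [].
  have [i_lt|i_ge] := ltnP i m.
    by rewrite (@sum_expr_finField _ (k - m + i)) -/k ?ifF ?mul0r ?mulr0 //; lia.
  by rewrite (@sum_expr_finField _ (k - n + j)) -/k ?ifF ?mulr0 //; lia.
have := Fdeg m j.
case: (ltnP (m + n) (m + j)) => [_ ->|ij _]; rewrite ?mul0r //.
have {}jn : (j != n :> nat) by [].
by rewrite (@sum_expr_finField _ (k - n + j)) -/k ?ifF ?mulr0 //; lia.
Qed.

Section LinearFactors.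
Variables (K : fieldType) (I : Type) (u x z : I -> K).

(** The outer variable T goes with [u] and the inner variable S with [x], so coefficients are read
    off as those of T^i S^j. *)
Definition prod_linear (r : seq I) : {poly {poly K}} :=
  \prod_(i <- r) ((u i)%:P *: 'X + (x i *: 'X + (z i)%:P)%:P).

Lemma horner_prod_linear (r : seq I) (t s : K) :
  (prod_linear r).[t%:P].[s] = \prod_(i <- r) (u i * t + x i * s + z i).
Proof.
rewrite /prod_linear !horner_prod; apply: eq_bigr => i _.
by rewrite !(hornerE, hornerZ) /=; ring.
Qed.

Lemma prod_linear_cons (i0 : I) (r : seq I) (i j : nat) :
  (prod_linear (i0 :: r))`_i`_j =
    (if i == 0%N then 0 else u i0 * (prod_linear r)`_i.-1`_j)
  + ((if j == 0%N then 0 else x i0 * (prod_linear r)`_i`_j.-1)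
     + z i0 * (prod_linear r)`_i`_j).
Proof.
rewrite /prod_linear big_cons; set P := \prod_(_ <- r) _.
rewrite mulrDl -scalerAl !(coefD, coefZ, coefXM, coefCM).
rewrite mulrDl coefD -scalerAl !(coefZ, coefXM, coefCM).
by do 2![case: eqP => _ //=]; rewrite ?(coefZ, coef0, mulr0).
Qed.

Lemma coef_prod_linear_gt (r : seq I) (i j : nat) :
  (size r < i + j)%N -> (prod_linear r)`_i`_j = 0.
Proof.
elim: r i j => [|i0 r IHr] i j /= ij.
  rewrite /prod_linear big_nil coef1; case: eqP ij => [->|_ _] /=.
    by rewrite coef1; case: j.
  by rewrite coef0.
rewrite prod_linear_cons.
rewrite [in z i0 * _]IHr ?mulr0 ?addr0; last by lia.
case: i ij => [|i] ij /=; case: j ij => [|j] ij //=; rewrite ?IHr ?mulr0 ?addr0 //; lia.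
Qed.

Lemma size_prod_affine (r : seq I) :
  (size (\prod_(k <- r) (u k *: 'X + (x k)%:P))%R <= (size r).+1)%N.
Proof.
elim: r => [|k r IHr]; first by rewrite big_nil size_poly1.
rewrite big_cons; apply: leq_trans (size_polyMleq _ _) _.
have szL : (size (u k *: 'X + (x k)%:P)%R <= 2)%N.
  apply: leq_trans (size_polyD _ _) _; rewrite geq_max.
  rewrite (leq_trans (size_scale_leq _ _)) ?size_polyX //.
  by rewrite (leq_trans (size_polyC_leq1 _)).
by rewrite -subn1 leq_subLR (leq_trans (leq_add szL IHr)).
Qed.

(** The constants [z] do not contribute in top degree. What remains is homogeneous, so S can be set
    to 1. *)
Lemma coef_prod_linear_top (r : seq I) (i j : nat) : (i + j)%N = size r ->
  (prod_linear r)`_i`_j = (\prod_(k <- r) (u k *: 'X + (x k)%:P))`_i.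
Proof.
elim: r i j => [|i0 r IHr] i j /= ij.
  have [-> ->] : i = 0%N /\ j = 0%N by lia.
  by rewrite /prod_linear !big_nil !coef1.
rewrite prod_linear_cons (@coef_prod_linear_gt r i j) ?mulr0 ?addr0; last by lia.
rewrite big_cons mulrDl -scalerAl !(coefD, coefZ, coefXM, coefCM).
case: i ij => [|i] ij; case: j ij => [|j] ij //=.
- by rewrite mulr0 (IHr 0%N j) //; lia.
- rewrite (IHr i 0%N) ?addr0; last by lia.
  suff -> : (\prod_(k <- r) (u k *: 'X + (x k)%:P))`_i.+1 = 0 by rewrite mulr0 addr0.
  by have /leq_sizeP := size_prod_affine r; apply; lia.
- by rewrite (IHr i j.+1) ?(IHr i.+1 j) //; lia.
Qed.
End LinearFactors.

Section AffineBlocking.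
Variables (K : finFieldType) (I : finType) (x y : I -> K) (A : {set I}).

(* Jamison's theorem on affine blocking sets, applied to the points (x i, y i). *)
Lemma affine_blocking_card :
    (forall l s t, (l != 0) || (s != 0) ->
       exists2 i, i \in A & l * y i + s * x i + t = 0) ->
  (2 * #|K|.-1 < #|A|)%N.
Proof.
move=> blockA; have [i0 i0A _] := blockA 1 0 0 (introT orP (or_introl (oner_neq0 _))).
set k := #|K|.-1; rewrite ltnNge; apply/negP => Ak.
(* With i0 moved to the origin, the product of t dy + u dx + 1 over the other points is 1 at t = u =
   0 and vanishes at every other (t, u). Its values sum to 1, while its degree below 2 k forces the
   sum to be 0. *)
pose dy i := y i - y i0; pose dx i := x i - x i0.
pose r := enum (A :\ i0).
have r_lt : (size r < k + k)%N.
  by rewrite -cardE; move: Ak; rewrite (cardsD1 i0) i0A; lia.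
have Fdeg i j : (k + k < i + j)%N -> (prod_linear dy dx (fun=> 1) r)`_i`_j = 0.
  by move=> ij; apply: coef_prod_linear_gt; lia.
have := @sum_horner2 _ _ k k (leqnn _) (leqnn _) Fdeg.
rewrite coef_prod_linear_gt // subnn.
have F0 t u : (t != 0) || (u != 0) -> (prod_linear dy dx (fun=> 1) r).[t%:P].[u] = 0.
  (* The line t (y - y i0) + u (x - x i0) + 1 = 0 avoids i0, so another point blocks it. *)
  move=> /(blockA _ _ (1 - t * y i0 - u * x i0))[i iA i_on].
  have i_neq : i != i0.
    by apply: contra_eqN i_on => /eqP->; rewrite (_ : _ + _ = 1) ?oner_eq0 //; ring.
  have ir : i \in r by rewrite mem_enum !inE i_neq.
  rewrite horner_prod_linear (big_rem i ir) /=.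
  by rewrite (_ : dy i * t + dx i * u + 1 = 0) ?mul0r // -i_on /dy /dx; ring.
rewrite (bigD1 0) //= (bigD1 0) //= !big1 ?addr0.
- rewrite horner_prod_linear big1 => [|i _]; last by rewrite !mulr0 !add0r.
  by rewrite !expr0 !mulr1 => /eqP; rewrite oner_eq0.
- by move=> t t0; apply: big1 => u _; rewrite F0 ?t0 ?mulr0.
- by move=> u u0; rewrite F0 ?u0 ?orbT ?mulr0.
Qed.

(** Since every line y + s x + t = 0 is blocked, the product of the T + x i S + y i vanishes on K x
    K. The coefficient formula then kills T^m S^(|A| - m), as both exponents are below q; this is a
    top-degree coefficient, hence one of the product of the X + x i. *)
Lemma affine_blocking_lacunary (m : nat) :
    (forall s t, exists2 i, i \in A & y i + s * x i + t = 0) ->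
    (m < #|K|)%N -> (#|A| < m + #|K|)%N ->
  (\prod_(i in A) ('X + (x i)%:P))`_m = 0.
Proof.
move=> blockA mK Am; have K_gt1 := card_finNzRing_gt1 K.
rewrite -big_enum; set r := enum A.
rewrite (eq_bigr (fun i => 1 *: 'X + (x i)%:P)) => [|i _]; last by rewrite scale1r.
have r_sz : size r = #|A| by rewrite -cardE.
have [m_le|m_gt] := leqP m #|A|; last first.
  by have /leq_sizeP := size_prod_affine (fun=> 1) x r; apply; rewrite r_sz.
have mn : (m + (#|A| - m))%N = size r by rewrite subnKC.
rewrite -(coef_prod_linear_top (fun=> 1) x y mn).
rewrite -sum_horner2; [|lia|lia|] => [|i j]; last first.
  by rewrite mn; apply: coef_prod_linear_gt.
apply: big1 => t _; apply: big1 => s _.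
have [i iA i_on] := blockA s t.
have ir : i \in r by rewrite mem_enum.
rewrite horner_prod_linear (big_rem i ir) /=.
by rewrite (_ : 1 * t + x i * s + y i = 0) ?mul0r ?mulr0 // -i_on; ring.
Qed.

End AffineBlocking.

(** * Lacunary polynomials that split over the base field *)

Lemma dvdp_prod_XsubC_exp (K : fieldType) (m : K -> nat) (s : seq K) (W : {poly K}) :
    uniq s -> (forall a, ('X - a%:P) ^+ m a %| W) ->
  \prod_(a <- s) ('X - a%:P) ^+ m a %| W.
Proof.
move=> + dvdW; elim: s => [|a s IHs] /= => [_|/andP[a_s /IHs{}IHs]].
  by rewrite big_nil dvd1p.
rewrite big_cons Gauss_dvdp ?dvdW //; apply: coprimep_expl.
rewrite coprimep_sym coprimep_XsubC rootE horner_prod prodf_seq_neq0.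
apply/allP => b bs; rewrite horner_exp !hornerE expf_neq0 // subr_eq0.
by apply: contraNneq a_s => ->.
Qed.

(** Comparing lowest terms at a, the orders n of f and j of g agree modulo p. If j < n this
    contradicts n < p, so the power of X - a dividing g can be raised up to n. *)
Lemma mulf_deriv_multiplicity (K : fieldType) (p : nat) (f1 g : {poly K}) (a : K) (n : nat) :
    p \in [pchar K] -> (n < p)%N -> f1.[a] != 0 ->
    let f := ('X - a%:P) ^+ n * f1 in
    f^`() * g = f * g^`() ->
  ('X - a%:P) ^+ n %| g.
Proof.
move=> pK np f1a /= fg.
suff: forall j, (j <= n)%N -> ('X - a%:P) ^+ j %| g by apply.
elim=> [|j IHj] jn; first by rewrite expr0 dvd1p.
have /dvdpP[g1 g_def] := IHj (ltnW jn).
have n_gt0 : (0 < n)%N by lia.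
set X := 'X - a%:P in fg g_def *.
have dX k : (X ^+ k)^`() * X = k%:R *: X ^+ k.
  rewrite deriv_exp derivXsubC mul1r scaler_nat mulrnAl.
  by case: k => [|k]; rewrite ?mulr0n // exprSr.
have X0 : X != 0 by rewrite polyXsubC_eq0.
(* At a this reads n f1 g1 = j f1 g1, and 0 < n - j < p forces g1 to vanish there. *)
have key : (n%:R *: f1 + X * f1^`()) * g1 = f1 * (j%:R *: g1 + X * g1^`()).
  clearbody X; have /mulfI : X ^+ (n + j) != 0 by rewrite expf_neq0.
  apply.
  have : (X ^+ n * f1)^`() * X * g = X ^+ n * f1 * (g^`() * X).
    by rewrite mulrAC fg mulrA.
  rewrite g_def !derivM !mulrDl.
  rewrite [(X ^+ n)^`() * f1 * X]mulrAC dX -[g1 * _ * X]mulrA dX exprD.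
  rewrite -!mul_polyC => E.
  transitivity (((n%:R)%:P * X ^+ n * f1 + X ^+ n * f1^`() * X) * (g1 * X ^+ j)).
    by ring.
  by rewrite mulrDl E; ring.
have /(congr1 (fun P => P.[a])) := key.
rewrite !(hornerE, hornerZ) subrr !mul0r !addr0.
move=> /eqP; rewrite [n%:R * _]mulrC -mulrA (inj_eq (mulfI f1a)) -subr_eq0 -mulrBl.
rewrite -natrB ?(ltnW jn) // mulf_eq0 -(dvdn_pcharf pK) gtnNdvd ?subn_gt0 //; last first.
  by rewrite (leq_ltn_trans (leq_subr _ _)).
by move=> /= g1a; rewrite g_def exprS dvdp_mul2r ?expf_neq0 // dvdp_XsubCl.
Qed.

(** [A] indexes the roots of f with multiplicity. For k = |A| - q, failure of the bound means 2 k <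
    q, which is what the degree comparison needs. *)
Lemma card_lacunary_split (K : finFieldType) (p : nat) (I : finType) (r : I -> K) (A : {set I})
    (q := #|K|) (f := \prod_(i in A) ('X - (r i)%:P)) :
    p \in [pchar K] ->
    (forall m, (m < q)%N -> (#|A| < m + q)%N -> f`_m = 0) ->
    (forall a, (#|[set i in A | r i == a]| < p)%N) ->
    (exists a, [forall i in A, r i != a]) ->
  (3 * q <= 2 * #|A|)%N.
Proof.
move=> pK flac m_lt [a0 /forall_inP a0P]; rewrite leqNgt; apply/negP => A_lt.
have q_gt1 : (1 < q)%N := card_finNzRing_gt1 K.
pose m a := #|[set i in A | r i == a]|.
have fE : f = \prod_(a : K) ('X - a%:P) ^+ m a.
  rewrite /f (partition_big r predT) //=; apply: eq_bigr => a _.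
  rewrite -prodr_const; apply: eq_big => [i|i /andP[_ /eqP->]] //.
  by rewrite inE.
have szf : size f = #|A|.+1 by rewrite /f -big_enum size_prod_XsubC -cardE.
(* Otherwise lacunarity would apply to the leading coefficient of the monic f. *)
have qA : (q <= #|A|)%N.
  rewrite leqNgt; apply/negP => Aq.
  have /eqP := flac _ Aq (ltn_addl _ Aq).
  have -> : f`_#|A| = lead_coef f by rewrite lead_coefE szf.
  rewrite (monicP _) ?oner_eq0 // /f.
  exact: monic_prod_XsubC.
set k := (#|A| - q)%N.
have kA : (q + k)%N = #|A| by rewrite subnKC.
pose g := drop_poly q f; pose h := take_poly q f.
have f_gh : f = g * 'X^q + h by rewrite addrC poly_take_drop.
have szg : size g = k.+1 by rewrite size_drop_poly szf subSn.
have szh : (size h <= k.+1)%N.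
  apply/leq_sizeP => j kj; rewrite coef_take_poly; case: ifP => // jq.
  by apply: flac => //; lia.
have df : f^`() = g^`() * 'X^q + h^`().
  rewrite f_gh derivD derivM derivXn -mulr_natr.
  by rewrite -(rmorph_nat polyC) natr_card_finField !mulr0 addr0.
pose D := f^`() * g - f * g^`().
(* The derivative of X^q is 0, so the terms in X^q cancel and D has size at most 2 k. *)
have DE : D = h^`() * g - h * g^`() by rewrite /D df f_gh; ring.
have evf a : f.[a] = ('X * g + h).[a].
  by rewrite f_gh !hornerE expf_card mulrC.
have mult a : exists2 f1, f = ('X - a%:P) ^+ m a * f1 & f1.[a] != 0.
  exists (\prod_(b | b != a) ('X - b%:P) ^+ m b); first by rewrite fE (bigD1 a).
  rewrite horner_prod; apply/prodf_neq0 => b ba.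
  by rewrite horner_exp !hornerE expf_neq0 // subr_eq0 eq_sym.
have f_dvd : f %| ('X * g + h) * D.
  rewrite [f]fE; apply: dvdp_prod_XsubC_exp; first exact: index_enum_uniq.
  (* At a root of multiplicity n + 1, X g + h supplies one factor, since it agrees with f on K, and
     D supplies the other n. *)
  move=> a; have [f1 f_def f1a] := mult a.
  case m_def : (m a) f_def => [|n] f_def; first by rewrite expr0 dvd1p.
  rewrite exprS dvdp_mul //.
    by rewrite dvdp_XsubCl rootE -evf f_def !hornerE subrr expr0n mul0r.
  rewrite /D dvdp_sub //; last by rewrite f_def exprS -!mulrA dvdp_mull // dvdp_mulr.
  rewrite dvdp_mulr // f_def derivM dvdp_add //; last by rewrite exprS -mulrA dvdp_mull ?dvdp_mulr.
  by rewrite deriv_exp -mulr_natr mulrAC -!mulrA dvdp_mull // dvdp_mulr.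
have [W0|W_neq0] := eqVneq (('X * g + h) * D) 0; last first.
  (* A nonzero product has size at most (k + 2) + 2 k - 1, below the size q + k + 1 of f. *)
  have := dvdp_leq W_neq0 f_dvd; apply/negP; rewrite -ltnNge szf.
  have [D0|D_neq0] := eqVneq D 0; first by rewrite D0 mulr0 size_poly0.
  apply: leq_ltn_trans (size_polyMleq _ _) _.
  have szXgh : (size ('X * g + h)%R <= k.+2)%N.
    rewrite (leq_trans (size_polyD _ _)) // geq_max (leq_trans szh) // andbT.
    by rewrite (leq_trans (size_polyMleq _ _)) // size_polyX szg.
  have szM (u v : {poly K}) : (size u <= k.+1)%N -> (size v <= k.+1)%N ->
      (size (u^`() * v)%R <= k + k)%N.
    move=> uk vk; have [->|u'0] := eqVneq u^`() 0; first by rewrite mul0r size_poly0.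
    have := size_polyMleq u^`() v.
    have : (size u^`() < size u)%N.
      by apply: lt_size_deriv; apply: contraNneq u'0 => ->; rewrite linear0.
    lia.
  have szD : (size D <= k + k)%N.
    rewrite DE (leq_trans (size_polyD _ _)) // size_polyN geq_max.
    by rewrite szM ?szg //= mulrC szM ?szg.
  have := leq_add szXgh szD; rewrite -subn1 ltnS leq_subLR => /leq_trans; apply.
  lia.
move/eqP: W0; rewrite mulf_eq0 => /orP[/eqP gh0|].
  have := evf a0; rewrite gh0 horner0 /f horner_prod => /eqP.
  apply/negP/prodf_neq0 => i iA; rewrite !hornerE subr_eq0 eq_sym.
  exact: a0P.
rewrite /D subr_eq0 => /eqP fg.
have : f %| g.
  rewrite [f]fE; apply: dvdp_prod_XsubC_exp; first exact: index_enum_uniq.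
  move=> a; have [f1 f_def f1a] := mult a.
  by apply: (mulf_deriv_multiplicity pK (m_lt a) f1a); rewrite -f_def.
have g_neq0 : g != 0 by rewrite -size_poly_eq0 szg.
by move=> /(dvdp_leq g_neq0); rewrite szf szg; lia.
Qed.

(** * Blocking sets in the projective plane *)

Section DotProduct.
Variable K : fieldType.
Implicit Types a b v w : 'rV[K]_3.

Definition dot a v : K := (a *m v^T) 0 0.

Lemma dotE a v : dot a v = \sum_(i < 3) a 0 i * v 0 i.
Proof. by rewrite /dot mxE; apply: eq_bigr => i _; rewrite mxE. Qed.

Lemma dotDl a b v : dot (a + b) v = dot a v + dot b v.
Proof. by rewrite /dot mulmxDl mxE. Qed.

Lemma dotZl c a v : dot (c *: a) v = c * dot a v.
Proof. by rewrite /dot -scalemxAl mxE. Qed.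

Lemma dotBr a v w : dot a (v - w) = dot a v - dot a w.
Proof. by rewrite /dot linearB mulmxBr !mxE. Qed.

Lemma dotZr c a v : dot a (c *: v) = c * dot a v.
Proof. by rewrite /dot linearZ -scalemxAr mxE. Qed.

Lemma dot_eq0 a v : (dot a v == 0) = (a *m v^T == 0).
Proof.
apply/eqP/eqP => [av|av]; last by rewrite /dot av mxE.
by apply/matrixP => i j; rewrite !ord1 [LHS]av mxE.
Qed.

(** Provides coordinates (a, b, c) in which v is (0, 0, 1): with a as the line at infinity, x = b /
    a and y = c / a are affine coordinates and v is the vertical direction. *)
Lemma dual_basis_ex (a v : 'rV[K]_3) : v != 0 -> a != 0 -> dot a v = 0 ->
  exists b c, [/\ dot b v = 0, dot c v = 1, forall t, b + t *: a != 0
    & forall w, dot a w = 0 -> dot b w = 0 -> dot c w = 0 -> w = 0].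
Proof.
move=> v0 a0 av.
(* The functionals killing v form a space of dimension 2, so not all are multiples of a. *)
have /row_subPn[i ker_a] : ~~ (kermx v^T <= a)%MS.
  apply/negP => /mxrankS; rewrite mxrank_ker mxrank_tr !rank_rV v0 a0.
  by [].
set b := row i _ in ker_a.
have bv : dot b v = 0.
  by apply/eqP; rewrite dot_eq0 -row_mul mulmx_ker row0.
have /existsP[j vj] : [exists j, v 0 j != 0].
  apply: contraNT v0 => /existsPn vj; apply/eqP/rowP => j; rewrite mxE.
  by apply/eqP; have := vj j; rewrite negbK.
pose c : 'rV[K]_3 := (v 0 j)^-1 *: delta_mx 0 j.
have cv : dot c v = 1.
  rewrite dotZl dotE (bigD1 j) //= big1 ?addr0 => [|k kj]; rewrite mxE ?eqxx /=.
    by rewrite mul1r mulVf.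
  by rewrite (negPf kj) mul0r.
have ba t : b + t *: a != 0.
  apply: contra ker_a => /eqP /(canRL (addrK _)) ->.
  by rewrite sub0r -scaleNr scalemx_sub.
clearbody b c; exists b, c; split=> // w aw bw cw.
have M_free : row_free (col_mx a (col_mx b c)).
  apply: inj_row_free => u.
  rewrite -[u]hsubmxK -[rsubmx u]hsubmxK.
  move: (lsubmx u) (lsubmx (rsubmx u)) (rsubmx (rsubmx u)) => u1 u2 u3.
  rewrite !mul_row_col [u1]mx11_scalar [u2]mx11_scalar [u3]mx11_scalar !mul_scalar_mx.
  move: (u1 0 0) (u2 0 0) (u3 0 0) => {u u1 u2 u3} c1 c2 c3 E.
  have c30 : c3 = 0.
    have := congr1 (fun w => dot w v) E.
    by rewrite !dotDl !dotZl av bv cv !mulr0 !add0r mulr1 /dot mul0mx mxE.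
  have c20 : c2 = 0.
    apply: contraTeq isT => c20; have /negP[] := ba (c1 / c2).
    rewrite -(inj_eq (scalerI c20)) scalerDr scalerA mulrCA divff // mulr1 scaler0.
    by rewrite addrC -E c30 scale0r addr0.
  have c10 : c1 = 0.
    move: E; rewrite c20 c30 !scale0r !addr0 => /eqP.
    by rewrite scaler_eq0 (negPf a0) orbF => /eqP.
  by rewrite c10 c20 c30 !raddf0 !row_mx0.
have M_unit : (col_mx a (col_mx b c) : 'M_3) \in unitmx by rewrite -row_free_unit.
have Mw : col_mx a (col_mx b c) *m w^T = 0.
  move/eqP: aw; move/eqP: bw; move/eqP: cw; rewrite !dot_eq0 => /eqP cw /eqP bw /eqP aw.
  by rewrite !mul_col_mx aw bw cw !col_mx0.
apply: trmx_inj; rewrite trmx0; apply: (can_inj (mulKmx M_unit)).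
by rewrite mulmx0; exact: Mw.
Qed.
End DotProduct.

Section Blocking.
Variables (K : finFieldType) (I : finType) (v : I -> 'rV[K]_3).
Hypothesis v_neq0 : forall i, v i != 0.
Let q := #|K|.

Definition vblocking (A : {set I}) : bool :=
  [forall a : 'rV[K]_3, (a != 0) ==> [exists i in A, dot a (v i) == 0]].

Lemma vblockingP (A : {set I}) :
  reflect (forall a, a != 0 -> exists2 i, i \in A & dot a (v i) = 0) (vblocking A).
Proof.
apply: (iffP forallP) => [bA a a0|bA a].
  by have /implyP/(_ a0)/exists_inP[i iA /eqP] := bA a; exists i.
by apply/implyP => /bA[i iA i_on]; apply/exists_inP; exists i => //; apply/eqP.
Qed.

Lemma vblocking_card (p : nat) (A : {set I}) : p \in [pchar K] -> vblocking A ->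
    (forall a, a != 0 -> (#|[set i in A | dot a (v i) == 0%R]| <= p)%N) ->
  (3 * q + 2 <= 2 * #|A|)%N.
Proof.
move=> pK blockA A_le; have q_gt1 : (1 < q)%N := card_finNzRing_gt1 K.
have [B /minsetP[blockB minB] BA] := minset_exists blockA.
have cardBA := subset_leq_card BA; move/vblockingP: (blockB) => blockBP.
have [P PB _] : exists2 P, P \in B & dot (const_mx 1) (v P) = 0.
  apply: blockBP; apply/eqP => /rowP/(_ 0); rewrite !mxE => /eqP.
  by rewrite oner_eq0.
have cardB := cardsD1 P B; rewrite PB in cardB.
set C := B :\ P in cardB.
(* By minimality some line a meets B only in P; this tangent becomes the line at infinity and C the
   affine part. *)
have : ~~ vblocking C.
  apply/negP => /minB/(_ (subsetDl _ _)) CB.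
  by move: PB; rewrite -CB !inE eqxx.
rewrite negb_forall => /existsP[a]; rewrite negb_imply => /andP[a0].
rewrite negb_exists_in => /forall_inP aC.
have aP : dot a (v P) = 0.
  have [R RB aR] := blockBP a a0; have [<- //|RP] := eqVneq R P.
  by have := aC R; rewrite aR eqxx !inE RP RB => /(_ isT).
have [b [c [bP cP ba _]]] := dual_basis_ex (v_neq0 P) a0 aP.
pose x R := dot b (v R) / dot a (v R); pose y R := dot c (v R) / dot a (v R).
have on_line l s t R : R \in C ->
    (dot (l *: c + s *: b + t *: a) (v R) == 0) = (l * y R + s * x R + t == 0).
  move=> RC; rewrite -[RHS](inj_eq (mulIf (aC R RC))) mul0r !mulrDl.
  by rewrite /x /y -!mulrA !mulVf ?aC // !mulr1 !dotDl !dotZl.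
have lineP l s t : dot (l *: c + s *: b + t *: a) (v P) = l.
  by rewrite !dotDl !dotZl aP bP cP !mulr0 mulr1 !addr0.
have nonvertical l s t : l != 0 -> exists2 R, R \in C & l * y R + s * x R + t = 0.
  move=> l0; pose e := l *: c + s *: b + t *: a.
  have eP : dot e (v P) != 0 by rewrite lineP.
  have [|R RB eR] := blockBP e.
    by apply: contraNneq eP => ->; rewrite /dot mul0mx mxE.
  have RC : R \in C.
    by rewrite !inE RB andbT; apply: contraNneq eP => <-; apply/eqP.
  by exists R => //; apply/eqP; rewrite -on_line //; apply/eqP.
(* The vertical line b + t0 a missing C is a second tangent at P; its parameter t0 is the value that
   is not a root of f. *)
have [/existsP[t0 /forall_inP t0C]|] :=
    boolP [exists t, [forall R in C, dot (0 *: c + 1 *: b + t *: a) (v R) != 0]].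
  have : (3 * q <= 2 * #|C|)%N.
    apply: (@card_lacunary_split K p I (fun R => - x R) C pK) => [m mq Cm|t|].
    - under eq_bigr => R _ do rewrite rmorphN opprK.
      apply: (affine_blocking_lacunary (y := y)) => // s t.
      by have [R RC <-] := nonvertical 1 s t (oner_neq0 _); exists R; rewrite ?mul1r.
    (* The points with - x = t lie on the vertical line b + t a, which also contains P, so there are
       at most p - 1 of them. *)
    - have ln0 : 0 *: c + 1 *: b + t *: a != 0 by rewrite scale0r scale1r add0r.
      apply: leq_trans (A_le _ ln0).
      apply: (@leq_trans #|P |: [set R in C | - x R == t]|).
        by rewrite cardsU1 !inE eqxx.
      apply/subset_leq_card/subsetP => R; rewrite !inE => /orP[/eqP->|].
        by rewrite (subsetP BA) // lineP eqxx.
      move=> /andP[/andP[RP RB] /eqP xR]; rewrite (subsetP BA) //=.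
      by rewrite on_line ?inE ?RP // -xR mul0r mul1r add0r subrr.
    - exists t0; apply/forall_inP => R RC; have := t0C R RC.
      by rewrite on_line // mul0r mul1r add0r addr_eq0 eqr_oppLR.
  lia.
rewrite negb_exists => /forallP vertical.
(* Now C meets all affine lines, so |B| >= 2 q, and 4 q >= 3 q + 2 as q >= 2. *)
have := @affine_blocking_card K I x y C; rewrite -/q => cardC.
suff /cardC : forall l s t, (l != 0) || (s != 0) ->
    exists2 R, R \in C & l * y R + s * x R + t = 0 by lia.
move=> l s t; have [-> /= s0|l0 _] := eqVneq l 0; last exact: nonvertical.
have := vertical (t / s); rewrite negb_forall_in => /exists_inP[R RC].
rewrite negbK on_line // => /eqP xR; exists R => //.
by transitivity (s * (0 * y R + 1 * x R + t / s)); [field | rewrite xR mulr0].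
Qed.
End Blocking.

(** * Points, lines and curves *)

Section ProjectivePoints.
Variables (K : finFieldType) (n : nat).
Implicit Type P : proj K n.

Lemma representative_neq0 P : representative P != 0.
Proof. by have [] := representativeP P. Qed.

Lemma mem_point P (v : 'rV[K]_n.+1) :
  (v \in val P) = [exists c : K, (c != 0) && (v == c *: representative P)].
Proof.
have [_ ->] := representativeP P.
apply/imsetP/existsP => [[c]|[c /andP[c0 /eqP->]]]; last by exists c; rewrite ?inE.
by rewrite !inE => c0 ->; exists c; rewrite c0 eqxx.
Qed.

Lemma representative_inj_scale P P' (c : K) :
  representative P = c *: representative P' -> P = P'.
Proof.
move=> PP'; have c0 : c != 0.
  by apply: contraNneq (representative_neq0 P) => c0; rewrite PP' c0 scale0r.
apply/val_inj/setP => v; rewrite !mem_point.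
apply/existsP/existsP => -[b /andP[b0 /eqP->]].
  by exists (b * c); rewrite mulf_neq0 //= PP' scalerA.
by exists (b / c); rewrite mulf_neq0 ?invr_eq0 //= PP' scalerA divfK.
Qed.

(** A nonzero vector is a unique nonzero scalar times the representative of a unique point. *)
Lemma card_proj : (#|{: proj K n}| * #|K|.-1 = (#|K| ^ n.+1).-1)%N.
Proof.
have <- : #|[set~ (0 : K)]| = #|K|.-1 by rewrite cardsC1.
have <- : #|[set~ (0 : 'rV[K]_n.+1)]| = (#|K| ^ n.+1).-1 by rewrite cardsC1 card_mx mul1n.
rewrite -cardsT -cardsX.
pose h (u : proj K n * K) := u.2 *: representative u.1.
rewrite -(@card_in_imset _ _ h) => [|[P b] [P' b']]; last first.
  rewrite !inE /h /= => b0 b'0 E.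
  have PP' : P = P'.
    apply: (@representative_inj_scale _ _ (b^-1 * b')).
    by rewrite -scalerA -E scalerA mulVf // scale1r.
  move: E; rewrite PP' => /eqP; rewrite -subr_eq0 -scalerBl scaler_eq0.
  by rewrite (negPf (representative_neq0 _)) orbF subr_eq0 => /eqP->.
apply: eq_card => v; apply/imsetP/idP => [[[P b]]|].
  by rewrite !inE /h /= => b0 ->; rewrite scaler_eq0 negb_or b0 representative_neq0.
move=> v0; have vP : scalar_class v \in [set scalar_class v | v in [set~ (0 : 'rV[K]_n.+1)]].
  exact: imset_f.
pose P : proj K n := exist (fun S => S \in _) _ vP.
have : v \in val P by apply/imsetP; exists 1; rewrite ?inE ?oner_eq0 ?scale1r.
rewrite mem_point => /existsP[c /andP[c0 /eqP->]].
by exists (P, c); rewrite ?inE.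
Qed.
End ProjectivePoints.

(** The [m i] are only degree bounds, so the top coefficients may be zero. *)
Lemma prod_top_coef (K : fieldType) (I : Type) (s : seq I) (F : I -> {poly K}) (m : I -> nat) :
    (forall i, size (F i) <= (m i).+1)%N ->
  (size (\prod_(i <- s) F i)%R <= (\sum_(i <- s) m i).+1)%N /\
  (\prod_(i <- s) F i)`_(\sum_(i <- s) m i)%N = \prod_(i <- s) (F i)`_(m i).
Proof.
move=> szF; elim: s => [|i s [IHsz IHcoef]].
  by rewrite !big_nil size_poly1 coef1.
rewrite !big_cons; set P := \prod_(j <- s) F j in IHsz IHcoef *.
set k := (\sum_(j <- s) m j)%N in IHsz IHcoef *; split.
  apply: leq_trans (size_polyMleq _ _) _.
  by rewrite -subn1 leq_subLR (leq_trans (leq_add (szF i) IHsz)) // addSn addnS.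
rewrite coefM (bigD1 (inord (m i))) //= inordK ?ltnS ?leq_addr // addKn IHcoef.
rewrite [X in _ + X]big1 ?addr0 // => j jm.
have [ji|ji] := leqP j (m i); last first.
  by rewrite (nth_default _ (leq_trans (szF i) ji)) mul0r.
rewrite [P`_ _](nth_default _ (leq_trans IHsz _)) ?mulr0 //.
have : j != m i :> nat.
  by apply: contraNneq jm => jm; apply/eqP/val_inj; rewrite /= inordK ?ltnS ?leq_addr.
lia.
Qed.

Lemma exp_top_coef (K : fieldType) (L : {poly K}) (n : nat) : (size L <= 2)%N ->
  (size (L ^+ n)%R <= n.+1)%N /\ (L ^+ n)`_n = L`_1 ^+ n.
Proof.
move=> szL; have [] := @prod_top_coef _ _ (iota 0 n) (fun=> L) (fun=> 1%N) (fun=> szL).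
by rewrite sum1_size !big_const_seq !count_predT size_iota !iter_mulr_1.
Qed.

Section LinesAndCurves.
Variable K : finFieldType.
Implicit Types (P R : proj K 2) (a : 'rV[K]_3) (B : {set proj K 2}).

Lemma mem_line a P : (P \in ratpoints (linear_form a)) = (dot a (representative P) == 0).
Proof.
rewrite inE /linear_form raddf_sum dotE; congr (_ == _).
by apply: eq_bigr => i _; rewrite /= mevalZ mevalXU.
Qed.

Lemma blocking_setE B : blocking_set B = vblocking (@representative K 2) B.
Proof.
by apply: eq_forallb => a; congr (_ ==> _); apply: eq_existsb => P; rewrite mem_line.
Qed.

(* Affine coordinate tau on the line a with the point R at infinity. *)
Lemma line_coordinate a R : a != 0 -> dot a (representative R) = 0 ->
  exists (w : 'rV[K]_3) (tau : proj K 2 -> K),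
    {in [set P | dot a (representative P) == 0] :\ R &, injective tau} /\
    {in [set P | dot a (representative P) == 0] :\ R,
       forall P, w + tau P *: representative R \in val P}.
Proof.
move=> a0 aR; set r := representative R in aR *.
have [b [c [bR cR _ abc0]]] := dual_basis_ex (representative_neq0 R) a0 aR.
set L := _ :\ R.
have bL P : P \in L -> dot b (representative P) != 0.
  rewrite !inE => /andP[PR /eqP aP]; apply: contra PR => /eqP bP; apply/eqP.
  apply: (@representative_inj_scale _ _ _ _ (dot c (representative P))).
  apply/eqP; rewrite -subr_eq0; apply/eqP; apply: abc0.
  - by rewrite dotBr dotZr aP aR mulr0 subr0.
  - by rewrite dotBr dotZr bP bR mulr0 subr0.
  - by rewrite dotBr dotZr cR mulr1 subrr.
have [L0|[P0 P0L]] := set_0Vmem L.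
  by exists 0, (fun=> 0); rewrite L0; split=> P; rewrite inE.
(* Points of L have b nonzero and are scaled to b = 1. Two such vectors then differ by a multiple of
   r, measured by c. *)
pose nrm P := (dot b (representative P))^-1 *: representative P.
pose w := nrm P0; pose tau P := dot c (nrm P) - dot c w.
have nrmE P : P \in L -> nrm P = w + tau P *: r.
  move=> PL; have bP := bL P PL; have bP0 := bL P0 P0L.
  have aP : dot a (nrm P) = 0.
    by move: PL; rewrite !inE dotZr => /andP[_ /eqP->]; rewrite mulr0.
  have aw : dot a w = 0.
    by move: P0L; rewrite !inE dotZr => /andP[_ /eqP->]; rewrite mulr0.
  apply/eqP; rewrite -subr_eq0 opprD addrA; apply/eqP; apply: abc0.
  - by rewrite !dotBr dotZr aP aw aR mulr0 !subr0.
  - by rewrite !dotBr !dotZr bR mulr0 subr0 !mulVf // subrr.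
  - by rewrite !dotBr (dotZr _ _ r) cR mulr1 subrr.
exists w, tau; split=> [P P' PL P'L tauP|P PL].
  have : nrm P = nrm P' by rewrite !nrmE // tauP.
  rewrite /nrm => /(canRL (scalerK _)); rewrite invr_eq0 bL // => /(_ isT).
  by rewrite scalerA; apply: representative_inj_scale.
rewrite -nrmE // mem_point; apply/existsP.
by exists (dot b (representative P))^-1; rewrite invr_eq0 bL /=.
Qed.

Lemma card_line_proper a R B : a != 0 -> dot a (representative R) = 0 -> R \notin B ->
  (#|[set P in B | dot a (representative P) == 0%R]| <= #|K|)%N.
Proof.
move=> a0 aR RB; have [w [tau [tau_inj _]]] := line_coordinate a0 aR.
rewrite -(card_in_imset (f := tau)) ?max_card // => P P'.
rewrite !inE => /andP[PB aP] /andP[P'B aP'].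
apply: tau_inj; rewrite !inE ?aP ?aP' andbT.
  by apply: contraNneq RB => <-.
by apply: contraNneq RB => <-.
Qed.

Definition restrict_line (f : {mpoly K[3]}) (w r : 'rV[K]_3) : {poly K} :=
  \sum_(m <- msupp f) f@_m *: \prod_(i < 3) ((w 0 i)%:P + r 0 i *: 'X) ^+ m i.

Lemma horner_restrict_line f w r t : (restrict_line f w r).[t] = f.@[(w + t *: r) 0].
Proof.
rewrite /restrict_line horner_sum mevalE; apply: eq_bigr => m _.
rewrite hornerZ horner_prod; congr (_ * _); apply: eq_bigr => i _.
by rewrite !hornerE !mxE mulrC.
Qed.

(** Each monomial of f has degree d, so only the r-parts of its factors reach t^d. Hence the
    restriction is nonzero if the direction r is off the curve. *)
Lemma restrict_line_top (d : nat) f w r : f \is d.-homog ->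
  (size (restrict_line f w r) <= d.+1)%N /\ (restrict_line f w r)`_d = f.@[r 0].
Proof.
move=> fd; rewrite /restrict_line.
have top (m : 'X_{1..3}) : m \in msupp f ->
    (size (\prod_(i < 3) ((w 0 i)%:P + r 0 i *: 'X) ^+ m i)%R <= d.+1)%N /\
    (\prod_(i < 3) ((w 0 i)%:P + r 0 i *: 'X) ^+ m i)`_d = \prod_(i < 3) r 0 i ^+ m i.
  move=> mf; have <- : mdeg m = d := dhomog_mf fd mf.
  have szL (i : 'I_3) : (size ((w 0 i)%:P + r 0 i *: 'X)%R <= 2)%N.
    apply: leq_trans (size_polyD _ _) _; rewrite geq_max.
    rewrite (leq_trans (size_polyC_leq1 _)) //.
    by rewrite (leq_trans (size_scale_leq _ _)) ?size_polyX.
  have szE i := (exp_top_coef (m i) (szL i)).1.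
  rewrite mdegE; have [sz ->] := @prod_top_coef _ _ (index_enum _) _ _ szE.
  split=> //; apply: eq_bigr => i _; rewrite (exp_top_coef (m i) (szL i)).2.
  by rewrite coefD coefC coefZ coefX add0r mulr1.
split; last first.
  rewrite coef_sum mevalE; apply: eq_big_seq => m /top[_ mE].
  by rewrite coefZ mE.
rewrite big_seq; apply: (big_ind (fun P : {poly K} => (size P <= d.+1)%N)).
- by rewrite size_poly0.
- by move=> P Q sP sQ; rewrite (leq_trans (size_polyD _ _)) // geq_max sP.
- by move=> m /top[sz _]; rewrite (leq_trans (size_scale_leq _ _)).
Qed.

(** With R as the point at infinity of the line, the coordinates of the intersection points are
    distinct roots of a nonzero polynomial of degree at most d. *)
Lemma card_line_curve a R (d : nat) (f : {mpoly K[3]}) :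
    f \is d.-homog -> a != 0 -> dot a (representative R) = 0 -> R \notin ratpoints f ->
  (#|[set P in ratpoints f | dot a (representative P) == 0%R]| <= d)%N.
Proof.
move=> fd a0 aR Rf; have [w [tau [tau_inj tauP]]] := line_coordinate a0 aR.
set S := [set P in _ | _].
have SL P : P \in S -> P \in [set P | dot a (representative P) == 0] :\ R.
  rewrite !inE => /andP[Pf ->]; rewrite andbT.
  by apply: contraNneq Rf => <-; rewrite inE.
have [sz top] := restrict_line_top w (representative R) fd.
set phi := restrict_line _ _ _ in sz top.
have phi0 : phi != 0.
  by apply: contraNneq Rf => phi0; rewrite inE -top phi0 coef0.
rewrite -ltnS (leq_trans _ sz) // cardE -(size_map tau).
apply: max_poly_roots phi0 _ _.
  apply/allP => _ /mapP[P + ->]; rewrite mem_enum => PS.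
  rewrite rootE horner_restrict_line -(mem_ratpoints fd (tauP P (SL P PS))).
  by move: PS; rewrite inE => /andP[].
rewrite map_inj_in_uniq ?enum_uniq // => P P'; rewrite !mem_enum => /SL PL /SL P'L.
exact: tau_inj.
Qed.
End LinesAndCurves.

(** * Pencils *)

Section Pencils.
Variables (K : finFieldType) (F G : {mpoly K[3]}).

Lemma mem_member (m : proj K 1) (P : proj K 2) :
  (P \in ratpoints (member F G m)) =
    (hcoord m 0 * F.@[hcoord P] + hcoord m 1 * G.@[hcoord P] == 0).
Proof. by rewrite inE /member mevalD !mevalZ. Qed.

(** Both parameter vectors are orthogonal to (F(P), G(P)), which is nonzero, so they are
    proportional. *)
Lemma member_unique (m m' : proj K 1) (P : proj K 2) : no_rational_base_point F G ->
  P \in ratpoints (member F G m) -> P \in ratpoints (member F G m') -> m = m'.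
Proof.
move=> base; rewrite !mem_member /hcoord -/(hcoord P).
have := base P; rewrite !inE.
set x := F.@[_]; set y := G.@[_]; set u := representative m; set u' := representative m'.
move=> xy /eqP um /eqP um'.
have det0 : u 0 0 * u' 0 1 = u' 0 0 * u 0 1.
  apply/eqP; rewrite -subr_eq0; apply/negPn/negP => D0; case: xy.
  split; rewrite -(inj_eq (mulfI D0)) mulr0; apply/eqP.
    transitivity (u' 0 1 * (u 0 0 * x + u 0 1 * y) - u 0 1 * (u' 0 0 * x + u' 0 1 * y)).
      by ring.
    by rewrite um um' !mulr0 subrr.
  transitivity (u 0 0 * (u' 0 0 * x + u' 0 1 * y) - u' 0 0 * (u 0 0 * x + u 0 1 * y)).
    by ring.
  by rewrite um um' !mulr0 subrr.
have [j uj] : exists j, u' 0 j != 0.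
  apply/existsP; apply: contraNT (representative_neq0 m') => /existsPn uj.
  by apply/eqP/rowP => j; rewrite mxE; apply/eqP; have := uj j; rewrite negbK.
apply: (@representative_inj_scale _ _ _ _ (u 0 j / u' 0 j)).
apply/rowP => i; rewrite mxE -/u -/u'; apply: (mulIf uj).
rewrite mulrAC divfK //.
have I2 (l : 'I_2) : l = 0 \/ l = 1.
  by case: l => [[|[|l]] Hl]; [left|right|]; try exact/val_inj.
by case: (I2 i) => ->; case: (I2 j) => -> //; rewrite det0 // mulrC.
Qed.
End Pencils.

Theorem theorem1p4 (p k q d : nat) (K : finFieldType) (F G : {mpoly K[3]})
    (p_prime : prime p) (k_gt0 : (0 < k)%N) (q_def : q = (p ^ k)%N)
    (cardK : #|K| = q)
    (FG_pencil : is_pencil d F G)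
    (FG_base : no_rational_base_point F G)
    (q_or_d : q = p \/ (d <= p)%N) :
  (q%:R + 1) / 3%:R
    <= #|[set m : proj K 1 | ~~ blocking_curve (member F G m)]|%:R :> rat.
Proof.
have pK : p \in [pchar K] by apply: (@card_finPcharP _ _ k); rewrite ?cardK.
have q_gt1 : (1 < q)%N by rewrite -cardK; exact: card_finNzRing_gt1.
have [_ Fd Gd _] := FG_pencil.
have md m : member F G m \is d.-homog by rewrite rpredD ?rpredZ.
have P1 : #|{: proj K 1}| = q.+1.
  apply/eqP; have := card_proj K 1; rewrite cardK.
  have -> : (q ^ 2).-1 = (q.+1 * q.-1)%N.
    by case: (q) q_gt1 => // r _; have -> : (r.+1 ^ 2 = r.+2 * r + 1)%N; [ring | rewrite addn1].
  by move=> /eqP; rewrite eqn_pmul2r //; lia.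
have P2 : #|{: proj K 2}| = (q * q + q + 1)%N.
  apply/eqP; have := card_proj K 2; rewrite cardK.
  have -> : (q ^ 3).-1 = ((q * q + q + 1) * q.-1)%N.
    case: (q) q_gt1 => // r _.
    by have -> : (r.+1 ^ 3 = (r.+1 * r.+1 + r.+1 + 1) * r + 1)%N; [ring | rewrite addn1].
  by move=> /eqP; rewrite eqn_pmul2r //; lia.
pose Bl := [set m : proj K 1 | blocking_curve (member F G m)].
suff Bl_le : (3 * #|Bl| <= 2 * q.+1)%N.
  have -> : [set m | ~~ blocking_curve (member F G m)] = ~: Bl.
    by apply/setP => m; rewrite !inE.
  rewrite ler_pdivrMr // -natrM natr1 ler_nat.
  have := cardsC Bl; rewrite P1; move: Bl_le.
  by move: #|Bl| #|~: Bl| => b nb; lia.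
have [/exists_inP[m mB /existsP[a /andP[a0 /subsetP aC]]]|] := boolP [exists m in Bl,
    exists a : 'rV[K]_3, (a != 0) && (ratpoints (linear_form a) \subset ratpoints (member F G m))].
  (* Any other blocking member meets the line a inside the member m, and members share no rational
     point. *)
  have : (#|Bl| <= 1)%N.
    apply/card_le1_eqP.
    suff Bm m' : m' \in Bl -> m' = m by move=> m1 m2 /Bm-> /Bm->.
    rewrite inE => /forallP/(_ a)/implyP/(_ a0)/exists_inP[P Pm' Pa].
    exact: (member_unique FG_base Pm' (aC P Pa)).
  lia.
rewrite negb_exists_in => /forall_inP noline.
have C_card m : m \in Bl -> (3 * q + 2 <= 2 * #|ratpoints (member F G m)|)%N.
  move=> mB; rewrite -cardK; apply: (vblocking_card (@representative_neq0 K 2) pK).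
    by rewrite -blocking_setE; move: mB; rewrite inE.
  move=> a a0; have := noline m mB; rewrite negb_exists => /forallP/(_ a).
  (* A point R of the line off the curve serves as the point at infinity in both cases. *)
  rewrite a0 /= => /subsetPn[R]; rewrite mem_line => /eqP aR Rm.
  case: q_or_d => [<-|]; first by rewrite -cardK; apply: card_line_proper aR Rm.
  by apply: leq_trans; apply: card_line_curve aR Rm.
have sumC : (\sum_(m in Bl) #|ratpoints (member F G m)| <= #|{: proj K 2}|)%N.
  under eq_bigr => m _ do rewrite -sum1_card.
  rewrite (exchange_big_dep predT) //= -sum1_card; apply: leq_sum => P _.
  rewrite sum1dep_card; apply/card_le1_eqP => m m'; rewrite !inE.
  by move=> /andP[_ mP] /andP[_ m'P]; apply: (member_unique (P := P) FG_base); rewrite inE.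
have : (#|Bl| * (3 * q + 2) <= 2 * #|{: proj K 2}|)%N.
  apply: leq_trans (leq_mul (leqnn 2) sumC); rewrite big_distrr /= -sum_nat_const.
  exact: leq_sum.
(* If 3 |Bl| >= 2 q + 3, then (2 q + 3) (3 q + 2) <= 6 (q^2 + q + 1), which is false. *)
by rewrite P2; nia.
Qed.
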